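(* Let $q$ and $r$ be integers such that $0\leq r<q$, let $a$ be a positive integer, and for each $n$ let $m=\lfloor n/a\rfloor$. Then \[\lim_{n\rightarrow\infty}\frac{\sum_{j=0}^{\lfloor m/q\rfloor} d_a(n,r+jq)}{D(n,a)}=\lim_{n\rightarrow\infty}\frac{d_a(n,r)+d_a(n,q+r)+\cdots+d_a(n,q\lfloor (m-r)/q\rfloor+r)}{D(n,a)}=\frac{1}{q}.\]
   Context: A permutation is called an $a$-derangement if each of its cycles is longer than $a$ (has length at least $a+1$). $d_a(n,k)$ denotes the number of $a$-derangements of length $n$ (i.e. of $\{1,\dots,n\}$) with exactly $k$ cycles, and $D(n,a)$ denotes the total number of $a$-derangements of length $n$. Note that $d_a(n,k)=0$ for $k>\lfloor n/(a+1)\rfloor$, so the two numerators are equal. *)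

(* Defs.v *)
From mathcomp Require Import all_boot all_fingroup.

Set Implicit Arguments.
Unset Strict Implicit.
Unset Printing Implicit Defensive.

(* [porbits s] is the set of supports of the cycles of [s]; a fixed point
   contributes a singleton, i.e. it counts as a cycle of length 1. *)
Definition is_derangement (a n : nat) (s : 'S_n) : bool :=
  [forall C in porbits s, a < #|C|].

Definition num_derangements (n a : nat) : nat :=
  #|[set s : 'S_n | is_derangement a s]|.

Definition num_derangements_cycles (a n k : nat) : nat :=
  #|[set s : 'S_n | is_derangement a s & #|porbits s| == k]|.

(* Main.v *)
(** Fix a residue [s] modulo [q] and let [e n s] be the proportion of
    permutations of [n] points that are [a]-derangements with [q] dividing
    [s + number of cycles]. Splitting off the cycle of one point gives
      [(n+1) e(n+1, s) = n e(n, s) + e(n-a, s+1)],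
    so up to an error O(1/n^2) the vector [e (n+1)] is [e n] averaged with its
    cyclic shift, with weight [1/(n+1)] on the shift. Such an average decreases
    the sum of squares by about [1/n] times the energy
    [E n = \sum_s (e n s.+1 - e n s) ^+ 2]; since [E] is almost nonincreasing
    and the harmonic series diverges, [E] tends to 0, and the [q] residue classes
    become equally frequent. Their total is the proportion of derangements,
    which the same recursion, read as a weighted mean of two earlier terms,
    keeps away from 0. *)

Require Import Defs.
From mathcomp Require Import all_boot all_fingroup.
From mathcomp Require Import zify.

Set Implicit Arguments.
Unset Strict Implicit.
Unset Printing Implicit Defensive.

(** * Splitting off the cycle of a point *)

Section OrbitSplitting.
Local Open Scope group_scope.
Variables (T : finType) (a : nat).
Implicit Types (A B : {set T}) (s t c : {perm T}) (x y : T) (P : pred nat).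

Lemma eq_in_porbit A s t : {in A, s =1 t} -> {in A, forall y, s y \in A} ->
  {in A, forall y, porbit s y = porbit t y}.
Proof.
move=> eq_st sA y yA.
have iterE n : (s ^+ n) y = (t ^+ n) y /\ (s ^+ n) y \in A.
  elim: n => [|n [IHe IHA]]; first by rewrite !expg0 !perm1.
  by rewrite !expgSr !permM -IHe eq_st // -eq_st ?sA.
apply/setP => z; apply/porbitP/porbitP => -[n ->]; exists n;
  by case: (iterE n).
Qed.

Lemma perm_on_sub_porbit B s x : perm_on B s -> x \in B -> porbit s x \subset B.
Proof.
move=> sB xB; apply/subsetP => _ /porbitP[n ->].
elim: n => [|n IHn]; first by rewrite expg0 perm1.
by rewrite expgSr permM perm_closed.
Qed.

(** The [a]-derangements of [B], kept as permutations of the ambient type so that removing a cycle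
    does not change the type. Taking orbits of points of [B] only ignores the fixed points outside
    [B]. *)
Definition long_cycle_perms B P : {set {perm T}} :=
  [set s | [&& perm_on B s, [forall x in B, a < #|porbit s x|]
            & P #|porbit s @: B|]].

Definition full_cycles A x : {set {perm T}} :=
  [set c | perm_on A c & porbit c x == A].

Lemma permM_disjoint A B c t : perm_on A c -> perm_on B t ->
  [disjoint A & B] -> c * t =1 (fun y => if y \in A then c y else t y).
Proof.
move=> cA tB dAB y; rewrite permM; case: ifPn => yA; last by rewrite (out_perm cA).
by rewrite (out_perm tB) // (disjointFr dAB) // perm_closed.
Qed.

Lemma perm_onS A B s : A \subset B -> perm_on A s -> perm_on B s.
Proof. by move=> AB sA; apply: subset_trans AB. Qed.

(** Such an [s] factors uniquely as a full cycle on [A] times an [a]-derangement of [B :\: A]. The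
    second factor has one cycle fewer, which turns [P] into [P \o succn]. *)
Lemma card_long_cycle_perms_porbit A B P x : x \in A -> A \subset B -> a < #|A| ->
  #|[set s in long_cycle_perms B P | porbit s x == A]| =
  (#|full_cycles A x| * #|long_cycle_perms (B :\: A) (P \o succn)|)%N.
Proof.
move=> xA AB aA; rewrite -cardsX.
have dAB : [disjoint A & B :\: A].
  by rewrite disjoints_subset; apply/subsetP => y yA; rewrite !inE yA.
have memD y : y \in A -> (y \in B :\: A) = false by move=> yA; rewrite inE yA.
have porbM c t : perm_on A c -> perm_on (B :\: A) t ->
    {in A, porbit (c * t) =1 porbit c} /\ {in B :\: A, porbit (c * t) =1 porbit t}.
  move=> cA tD; have ctE := permM_disjoint cA tD dAB.
  split; apply: eq_in_porbit => y yA; rewrite ctE ?yA ?perm_closed //;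
  by case: (setDP yA) => _ /negbTE -> //; rewrite perm_closed.
have porbU s : porbit s x = A -> {in A, porbit s =1 fun=> A}.
  by move=> sA y; rewrite -{1}sA -eq_porbit_mem sA => /eqP.
have imB s : porbit s x = A -> perm_on B s ->
    #|porbit s @: B| = #|porbit s @: (B :\: A)|.+1.
  move=> sA sB; rewrite -{1}(setID B A) (setIidPr AB) imsetU.
  have ->: porbit s @: A = [set A].
    apply/setP => C; rewrite inE; apply/imsetP/eqP => [[y /(porbU _ sA) -> ->]//|->].
    by exists x.
  rewrite cardsU1; case: imsetP => //= -[y /setDP[yB yA] AE].
  by rewrite AE porbit_id in yA.
rewrite -(card_in_imset (f := fun p : {perm T} * {perm T} => p.1 * p.2)).
  apply: eq_card => s; rewrite !inE; apply/andP/imsetP; last first.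
    case=> -[c t] /setXP[]; rewrite !inE => /andP[cA /eqP cx].
    case/and3P=> tD /forall_inP al Pt /= -> {s}.
    have [pc pt] := porbM _ _ cA tD.
    have ctx : porbit (c * t) x = A by rewrite pc.
    have ctB : perm_on B (c * t).
      by rewrite perm_onM ?(perm_onS AB cA) ?(perm_onS (subsetDl B A) tD).
    rewrite ctx ctB eqxx imB // (eq_in_imset pt) [P _]Pt andbT.
    split=> //; apply/forall_inP => y yB; case yA: (y \in A).
      by rewrite (porbU _ ctx).
    by rewrite pt ?al // inE yA.
  case=> /and3P[sB /forall_inP al Ps] /eqP sx.
  (* Surjectivity: [c] is the cycle of [x] in [s], and [t] is what remains once it is undone. *)
  pose c := restr_perm A s.
  have sN : s \in 'N(A | 'P).
    apply/astabsP => y /=; rewrite apermE -sx -!eq_porbit_mem.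
    by have := porbit_perm s 1 y; rewrite expg1 => ->.
  have cE : {in A, c =1 s} by move=> y yA; rewrite /c restr_permE.
  have cA : perm_on A c by apply: restr_perm_on.
  pose t := c^-1 * s.
  have tD : perm_on (B :\: A) t.
    apply/subsetP => y; rewrite !inE /t permM; apply: contraR.
    rewrite negb_and negbK; have [yA _|yA] := boolP (y \in A).
      by rewrite -cE ?permKV // perm_closed ?perm_onV.
    by rewrite (out_perm (perm_onV cA)) //= => yB; rewrite (out_perm sB).
  have sE : s = c * t by rewrite /t mulKVg.
  have [pc pt] := porbM _ _ cA tD.
  exists (c, t) => //; rewrite !inE cA -pc // -sE sx eqxx tD /=.
  apply/andP; split.
    apply/forall_inP => y yD; rewrite -pt // -sE al //.
    by case/setDP: yD.
  by rewrite -(eq_in_imset pt) -sE -imB.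
move=> [c t] [c' t']; rewrite !inE /=.
case/andP=> /andP[cA _] /and3P[tD _ _] /andP[/andP[cA' _] /and3P[tD' _ _]] e.
have E y : (c * t) y = (c' * t') y by rewrite e.
have [ctE ctE'] := (permM_disjoint cA tD dAB, permM_disjoint cA' tD' dAB).
congr pair; apply/permP => y; have:= E y; rewrite ctE ctE'; case: ifPn => yA //.
- by rewrite (out_perm cA) // (out_perm cA').
- by rewrite (out_perm tD) ?memD // (out_perm tD') ?memD.
Qed.

Lemma card_long_cycle_perms_split B P x : x \in B ->
  #|long_cycle_perms B P| =
  \sum_(A : {set T} | [&& x \in A, A \subset B & a < #|A|])
    (#|full_cycles A x| * #|long_cycle_perms (B :\: A) (P \o succn)|)%N.
Proof.
move=> xB; rewrite -sum1_card.
rewrite (partition_big (fun s => porbit s x)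
  (fun A => [&& x \in A, A \subset B & a < #|A|])) /=.
  apply: eq_bigr => A /and3P[xA AB aA].
  rewrite -card_long_cycle_perms_porbit // -sum1_card.
  by apply: eq_bigl => s; rewrite [in RHS]inE.
move=> s; rewrite !inE => /and3P[sB /forall_inP al _].
by rewrite porbit_id perm_on_sub_porbit // al.
Qed.

End OrbitSplitting.

(** * Recurrences by the size of the split-off cycle *)

Lemma sum_pointed_subsets (T : finType) (B : {set T}) x (F : nat -> nat) a : x \in B ->
  \sum_(A : {set T} | [&& x \in A, A \subset B & a < #|A|]) F #|A| =
  \sum_(a <= j < #|B|) 'C(#|B|.-1, j) * F j.+1.
Proof.
move=> xB.
(* Removing [x] leaves an arbitrary subset of [B :\ x] of size at least [a]. *)
transitivity (\sum_(A : {set T} | (A \subset B :\ x) && (a <= #|A|)) F #|A|.+1).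
  rewrite (reindex_onto (fun A => x |: A) (fun A => A :\ x)) /=; last first.
    by move=> A /and3P[xA _ _]; rewrite setD1K.
  apply: eq_big => [A|A].
    have [xA|xA] := boolP (x \in A).
      rewrite [RHS](_ : _ = false).
        apply: contraTF xA => /andP[_ /eqP <-]; by rewrite !inE eqxx.
      by apply/negP => /andP[/subsetP/(_ _ xA)]; rewrite !inE eqxx.
    by rewrite setU1K // eqxx andbT cardsU1 xA setU11 subUset sub1set xB
      subsetD1 xA andbT.
  by case/andP=> /and3P[_ _ _] /eqP <-; rewrite cardsU1 !inE eqxx.
rewrite (cardsD1 x B) xB add1n /=.
set D := B :\ x.
rewrite big_geq_mkord /=.
rewrite (partition_big (fun A : {set T} => inord #|A| : 'I_#|D|.+1)
  (fun j : 'I_#|D|.+1 => a <= j)) /=; last first.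
  by move=> A /andP[/subset_leq_card AD aA]; rewrite inordK.
apply: eq_big => [j|j aj] //.
rewrite -cards_draws -sum_nat_const.
apply: eq_big => [A|A].
  rewrite inE; apply/andP/andP => -[].
    by case/andP=> AD aA /eqP <-; split=> //; rewrite inordK // ltnS subset_leq_card.
  by move=> AD /eqP Aj; rewrite AD Aj aj; split=> //; apply/eqP/val_inj;
    rewrite /= inordK.
by case/andP=> /andP[AD _] /eqP <-; rewrite inordK // ltnS subset_leq_card.
Qed.

(* Strong induction, counting all permutations of [A] by the cycle of [x]. *)
Lemma card_full_cycles (T : finType) (A : {set T}) x : x \in A ->
  #|full_cycles A x| = #|A|.-1`!.
Proof.
have [n le_n] := ubnP #|A|; elim: n => // n IHn in A le_n *.
move=> xA.
(* For [a = 0] the length condition is void, so every permutation of [B] counts. *)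
have LT B : #|@long_cycle_perms T 0 B predT| = #|B|`!.
  rewrite -card_perm; apply: eq_card => s; rewrite inE andbT andb_idr // => _.
  by apply/forall_inP => y _; rewrite lt0n card_porbit_neq0.
pose F m := m.-1`! * (#|A| - m)`!.
have sumF : \sum_(A' : {set T} | [&& x \in A', A' \subset A & 0 < #|A'|])
    F #|A'| = #|A|`!.
  rewrite sum_pointed_subsets //.
  transitivity (\sum_(0 <= j < #|A|) #|A|.-1`!).
    apply: eq_big_nat => j /andP[_ jA]; rewrite /F /= mulnA.
    have -> : #|A| - j.+1 = #|A|.-1 - j by lia.
    by rewrite -mulnA bin_fact //; lia.
  rewrite sum_nat_const_nat subn0.
  by case: #|A| (cardD1 x A) => [|m] //=; rewrite xA.
have := card_long_cycle_perms_split 0 predT xA.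
have PA : [&& x \in A, A \subset A & 0 < #|A|].
  by rewrite xA subxx (cardD1 x) xA.
(* Both expansions of the factorial of [#|A|] agree at the proper subsets by induction, hence also
   at [A] itself. *)
rewrite LT -sumF (bigD1 A) // [RHS](bigD1 A) //= LT setDv cards0 muln1.
rewrite [F _]/F subnn muln1 => /eqP; rewrite eq_sym.
rewrite (eq_bigr (fun A' : {set T} => F #|A'|)) ?eqn_add2r; first by move/eqP.
move=> A' /andP[/and3P[xA' sA' _] nA'].
rewrite IHn ?LT ?cardsDS //.
have : A' \proper A by rewrite properEneq nA'.
by move/proper_card; lia.
Qed.

(** An arbitrary condition on the number of cycles keeps the family closed under [P \o succn], as
    the recurrence requires. *)
Definition num_derangements_such_that a n (P : pred nat) : nat :=
  #|[set s : 'S_n | is_derangement a s & P #|porbits s|]|.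

Lemma card_long_cycle_permsT a n (P : pred nat) :
  #|@long_cycle_perms 'I_n a setT P| = num_derangements_such_that a n P.
Proof.
have porbitsE (s : 'S_n) : porbit s @: setT = porbits s.
  by apply/setP => C; apply/imsetP/imsetP => -[i _ ->]; exists i.
apply: eq_card => s; rewrite !inE porbitsE; apply/and3P/andP.
  move=> [_ /forall_inP al Ps]; split=> //; apply/forall_inP => C /imsetP[i _ ->].
  by rewrite al.
case=> /forall_inP al Ps; split.
- by apply/subsetP => i _; rewrite inE.
- by apply/forall_inP => i _; rewrite al // imset_f.
- by [].
Qed.

(** The other [j] points of the cycle of [x] are chosen in ['C(n, j)] ways and arranged in [j]
    factorial ways, giving [n ^_ j]. The hypothesis stays explicit so that the formula can serve
    inside the induction that proves it. *)
Lemma card_long_cycle_perms_rec a n :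
  (forall m, m <= n -> forall (T : finType) (B : {set T}) P, #|B| = m ->
     #|long_cycle_perms a B P| = num_derangements_such_that a m P) ->
  forall (T : finType) (B : {set T}) P, #|B| = n.+1 ->
  #|long_cycle_perms a B P| =
  \sum_(a <= j < n.+1) n ^_ j * num_derangements_such_that a (n - j) (P \o succn).
Proof.
move=> IH T B P Bn.
have /card_gt0P[x xB] : 0 < #|B| by rewrite Bn.
rewrite (card_long_cycle_perms_split _ _ xB).
pose F m := m.-1`! * num_derangements_such_that a (n.+1 - m) (P \o succn).
transitivity (\sum_(A : {set T} | [&& x \in A, A \subset B & a < #|A|]) F #|A|).
  apply: eq_bigr => A /and3P[xA AB aA].
  by rewrite card_full_cycles // (IH (n.+1 - #|A|)) ?cardsDS ?Bn //; lia.
rewrite sum_pointed_subsets // Bn; apply: eq_bigr => j _.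
by rewrite /F /= mulnA bin_ffact subSS.
Qed.

(* The recursion determines the count, so it depends on [B] only through #|B|. *)
Lemma card_long_cycle_perms a (T : finType) (B : {set T}) P :
  #|long_cycle_perms a B P| = num_derangements_such_that a #|B| P.
Proof.
have [n] := ubnP #|B|; elim: n T B P => // n IHn T B P.
case Bn: #|B| => [|m] Hm.
  have C0 (T' : finType) (B' : {set T'}) : #|B'| = 0 ->
      #|long_cycle_perms a B' P| = P 0.
    move=> /cards0_eq ->.
    transitivity #|[set s : {perm T'} | (s == 1%g) && P 0]|; last first.
      case: (P 0).
        transitivity #|[set (1%g : {perm T'})]|; last by rewrite cards1.
        by apply: eq_card => s; rewrite !inE andbT.
      by apply: eq_card0 => s; rewrite !inE andbF.
    apply: eq_card => s; rewrite !inE imset0 cards0.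
    apply/and3P/andP => [[s0 _ P0]|[/eqP -> P0]]; split=> //.
    - by apply/eqP/(perm_on_id s0); rewrite cards0.
    - exact: perm_on1.
    - by apply/forall_inP => y; rewrite inE.
  by rewrite C0 // -card_long_cycle_permsT C0 // cardsT card_ord.
have IH k : k <= m -> forall (T : finType) (B : {set T}) P, #|B| = k ->
     #|long_cycle_perms a B P| = num_derangements_such_that a k P.
  by move=> km T' B' P' Bk; rewrite IHn Bk //; lia.
rewrite (card_long_cycle_perms_rec IH) // -card_long_cycle_permsT.
by rewrite (card_long_cycle_perms_rec IH) // cardsT card_ord.
Qed.

Lemma num_derangements_such_thatS a n P :
  num_derangements_such_that a n.+1 P =
  \sum_(a <= j < n.+1) n ^_ j * num_derangements_such_that a (n - j) (P \o succn).
Proof.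
rewrite -card_long_cycle_permsT (@card_long_cycle_perms_rec a n) ?cardsT ?card_ord //.
by move=> m _ T B Q <-; apply: card_long_cycle_perms.
Qed.

(** The term [j = a] gives the second summand; by [n ^_ j.+1 = n * n.-1 ^_ j] the others are [n]
    times the full sum for [n]. *)
Lemma num_derangements_such_that_rec a n P : 0 < n -> a <= n ->
  num_derangements_such_that a n.+1 P =
  n * num_derangements_such_that a n P +
  n ^_ a * num_derangements_such_that a (n - a) (P \o succn).
Proof.
case: n => // n _ an; rewrite [LHS]num_derangements_such_thatS big_ltn // addnC.
congr (_ + _); rewrite num_derangements_such_thatS big_add1 big_distrr /=.
by apply: eq_bigr => j _; rewrite ffactSS subSS mulnA.
Qed.

Lemma card_porbits_derangement a n (s : 'S_n) : 0 < a ->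
  is_derangement a s -> #|porbits s| <= n %/ a.
Proof.
move=> a0 /forall_inP al.
rewrite leq_divRL // -[leqRHS](card_ord n) -[leqRHS]sum1_card.
rewrite (partition_big (porbit s) (mem (porbits s))) => [|i _] /=; last first.
  exact: imset_f.
rewrite -sum_nat_const; apply: leq_sum => C Cs; rewrite sum1_card.
apply: (leq_trans (ltnW (al C Cs))); case/imsetP: Cs => i _ ->.
by apply/subset_leq_card/subsetP => j; rewrite -eq_porbit_mem unfold_in.
Qed.

Lemma num_derangements0 a : num_derangements 0 a = 1.
Proof.
rewrite -[1]/(0`!) -card_Sn; apply: eq_card => s; rewrite !inE.
by apply/forall_inP => C /imsetP[[]].
Qed.

(** * Cycle counts in residue classes *)

Section Statistics.
Variables (a n : nat).
Implicit Types P Q : pred nat.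

Lemma eq_num_derangements_such_that P Q : P =1 Q ->
  num_derangements_such_that a n P = num_derangements_such_that a n Q.
Proof. by move=> eqPQ; apply: eq_card => s; rewrite !inE eqPQ. Qed.

Lemma num_derangements_such_that_sumE P : num_derangements_such_that a n P =
  (\sum_(s : 'S_n | is_derangement a s) P #|porbits s|)%N.
Proof.
rewrite /num_derangements_such_that -sum1_card big_mkcond [RHS]big_mkcond /=.
by apply: eq_bigr => s _; rewrite inE; case: is_derangement => //=; case: P.
Qed.

Lemma num_derangements_such_that_le P :
  (num_derangements_such_that a n P <= n`!)%N.
Proof. by rewrite -card_Sn; apply: max_card. Qed.

Lemma num_derangements_such_that_predT :
  num_derangements_such_that a n predT = num_derangements n a.
Proof. by apply: eq_card => s; rewrite !inE andbT. Qed.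

Lemma sum_num_derangements_such_that_residue q : (0 < q)%N ->
  (\sum_(s < q) num_derangements_such_that a n (fun k => q %| k + s))%N =
  num_derangements n a.
Proof.
move=> q0; rewrite -num_derangements_such_that_predT num_derangements_such_that_sumE.
under eq_bigr do rewrite num_derangements_such_that_sumE.
rewrite exchange_big; apply: eq_bigr => s _ /=.
set c := #|porbits s|.
(* The unique [t < q] with [q %| c + t]; the outer reduction handles [q %| c]. *)
have lt_q : ((q - c %% q) %% q < q)%N by rewrite ltn_pmod.
rewrite (bigD1 (Ordinal lt_q)) //= big1 => [|[t tq] /eqP /= nt].
  rewrite addn0; apply/eqP; rewrite eqb1 /dvdn modnDmr -modnDml.
  by rewrite subnKC ?modnn // ltnW // ltn_pmod.
apply/eqP; rewrite eqb0; apply/negP => qct; apply: nt; apply/val_inj => /=.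
apply/eqP; rewrite -{1}(modn_small tq) -(eqn_modDl c).
rewrite (eqP qct) eq_sym -/(dvdn _ _).
by rewrite -/(dvdn q _) /dvdn -modnDml subnKC ?modnn // ltnW // ltn_pmod.
Qed.

(** The range given by [M] and [Q] only has to contain every attainable number of cycles, since
    larger [j] contribute 0; both sums of the theorem fit. The condition [q %| k + (q - r)] says
    that [k] is [r] modulo [q]. *)
Lemma sum_num_derangements_cycles q r M Q : (0 < a)%N -> (r < q)%N ->
  (forall j, (r + j * q <= n %/ a)%N -> (j < M)%N && Q j) ->
  (\sum_(0 <= j < M | Q j) num_derangements_cycles a n (r + j * q))%N =
  num_derangements_such_that a n (fun k => q %| k + (q - r)).
Proof.
move=> a0 rq MQ; rewrite num_derangements_such_that_sumE.
have cyclesE k : num_derangements_cycles a n k =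
    num_derangements_such_that a n (fun c => c == k) by [].
under eq_bigr do rewrite cyclesE num_derangements_such_that_sumE.
rewrite exchange_big; apply: eq_bigr => s /(card_porbits_derangement a0) /=.
set c := #|porbits s| => cle.
have [/dvdnP[t ct]|ndv] := boolP (q %| _)%N; last first.
  apply: big1 => j _; apply/eqP; rewrite eqb0; apply: contra ndv => /eqP ->.
  by rewrite addnAC subnKC ?(ltnW rq) // dvdn_addr // dvdn_mull.
(* [q - r > 0] forces [t > 0]; then [j = t - 1] is the only index that counts [s]. *)
have t0 : (0 < t)%N by case: t ct => //; lia.
have cE : c = (r + t.-1 * q)%N by nia.
have /andP[tM Qt] : (t.-1 < M)%N && Q t.-1 by apply: MQ; rewrite -cE.
rewrite big_mkcond (bigD1_seq t.-1) ?mem_index_iota ?iota_uniq //= Qt {1}cE eqxx.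
rewrite big1 ?addn0 // => j jt; case: ifP => // _.
apply/eqP; rewrite eqb0 cE eqn_add2l.
by rewrite eqn_pmul2r 1?eq_sym // (leq_ltn_trans _ rq).
Qed.

End Statistics.

From mathcomp Require Import all_order all_algebra.
From mathcomp Require Import all_classical all_reals all_analysis.
From mathcomp Require Import ring lra.

Import Order.TTheory GRing.Theory Num.Theory.
Import numFieldNormedType.Exports.

Local Open Scope classical_set_scope.
Local Open Scope ring_scope.

(** * Averaging with a delayed cyclic shift *)

(** The main terms are exactly the square of the convex combination; passing to [y], at distance at
    most [d], costs at most [2 * d] because both lie in [[-1, 1]]. *)
Lemma sqr_convex_comb_le (R : realFieldType) (h d u v y : R) :
  0 <= h <= 1 -> -1 <= u <= 1 -> -1 <= v <= 1 -> -1 <= y <= 1 ->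
  `|y - ((1 - h) * u + h * v)| <= d ->
  y ^+ 2 <= (1 - h) * u ^+ 2 + h * v ^+ 2 - h * (1 - h) * (v - u) ^+ 2 + 2 * d.
Proof.
move=> h01 u1 v1 y1; rewrite ler_norml => /andP[dl dr].
set x := (1 - h) * u + h * v in dl dr.
have x1 : -1 <= x <= 1 by rewrite /x; apply/andP; split; nra.
have -> : (1 - h) * u ^+ 2 + h * v ^+ 2 - h * (1 - h) * (v - u) ^+ 2 = x ^+ 2.
  by rewrite /x; ring.
nra.
Qed.

Lemma sum_shift_periodic (V : zmodType) (q : nat) (f : nat -> V) :
  f q = f 0%N -> \sum_(r < q) f r.+1 = \sum_(r < q) f r.
Proof.
move=> fq; apply: (@addrI _ (f 0%N)).
by rewrite -(big_ord_recl q (fun i => f i)) big_ord_recr /= fq addrC.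
Qed.

(* The weights [n / (n+1)^2] have divergent sum, whereas [F >= 0]. *)
Lemma dissipation_small (R : realType) (F G : nat -> R) (K : R) (N : nat) :
  0 <= K -> (forall n, 0 <= F n) ->
  (forall n, (N <= n)%N -> G n.+1 <= G n) ->
  (forall n, (N <= n)%N ->
     F n.+1 <= F n - n%:R / n.+1%:R ^+ 2 * (G n - K / n%:R)) ->
  forall eps, 0 < eps -> exists2 M, (N <= M)%N & forall n, (M <= n)%N -> G n < eps.
Proof.
move=> K0 F0 Gdec Fdec eps eps0.
suff [M NM GM] : exists2 M, (N <= M)%N & G M < eps.
  exists M => // n; elim: n => [|n IHn]; first by rewrite leqn0 => /eqP <-.
  rewrite leq_eqVlt ltnS => /orP[/eqP <- //|Mn].
  by rewrite (le_lt_trans _ (IHn Mn)) // Gdec // (leq_trans NM).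
apply: contrapT => noM.
have Geps n : (N <= n)%N -> eps <= G n.
  by move=> Nn; rewrite leNgt; apply/negP => lt; apply: noM; exists n.
(* Adding [K / n] absorbs the error: its decrease [K / (n (n+1))] is at least [K / (n+1)^2]. *)
pose H n := F n + K / n%:R.
have H0 n : 0 <= H n by rewrite addr_ge0 // divr_ge0.
have Hdec n : (N < n)%N -> H n.+1 <= H n - n%:R / n.+1%:R ^+ 2 * eps.
  move=> Nn; have := Fdec n (ltnW Nn); have := Geps n (ltnW Nn).
  have n0 : (0 : R) < n%:R by rewrite ltr0n (leq_ltn_trans _ Nn).
  rewrite /H -natr1; set x : R := n%:R in n0 *.
  move=> eG FF.
  have Kx : K / (x + 1) <= K / x - x / (x + 1) ^+ 2 * (K / x).
    have -> : K / x - x / (x + 1) ^+ 2 * (K / x)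
      = K / (x + 1) + K / (x * (x + 1) ^+ 2).
      by field; rewrite !gt_eqF //; lra.
    rewrite lerDl divr_ge0 // mulr_ge0 ?sqr_ge0 //; lra.
  have c0 : 0 <= x / (x + 1) ^+ 2 by rewrite divr_ge0 ?sqr_ge0 // ltW.
  have := ler_wpM2l c0 eG; rewrite mulrBr in FF; lra.
(* For indices from [n] to [2 n - 1] every weight is at least [1 / (4 n)]. *)
have Hblock n k : (N < n)%N -> (k <= n)%N ->
    H (n + k)%N <= H n - k%:R / (4 * n%:R) * eps.
  move=> Nn; elim: k => [_|k IHk kn]; first by rewrite addn0 !mul0r subr0.
  have n0 : (0 : R) < n%:R by rewrite ltr0n (leq_ltn_trans _ Nn).
  rewrite addnS (le_trans (Hdec _ _)) ?ltn_addr //.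
  have := IHk (ltnW kn).
  have w : (4 * n%:R)^-1 <= (n + k)%:R / (n + k).+1%:R ^+ 2 :> R.
    rewrite ler_pdivlMr ?exprn_gt0 ?ltr0n //.
    have : ((n + k).+1 ^ 2 <= (n + k) * (4 * n))%N by nia.
    rewrite -(ler_nat R) natrX !natrM => le.
    by rewrite mulrC ler_pdivrMr ?mulr_gt0.
  have := ler_wpM2r (ltW eps0) w.
  have -> : k.+1%:R / (4 * n%:R) * eps =
      k%:R / (4 * n%:R) * eps + (4 * n%:R)^-1 * eps :> R.
    by rewrite -(@natr1 _ k) (mulrDl k%:R) (mulrDl (k%:R / _)) mul1r.
  move: (k%:R / _ * eps) (_^-1 * eps) (_ / _ ^+ 2 * eps) => u v t; lra.
(* Each doubling of the index costs [H] at least [eps / 4], which a nonnegative [H] cannot afford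
   forever. *)
have Hiter j : H (N.+1 * 2 ^ j)%N + j%:R * (eps / 4) <= H N.+1.
  elim: j => [|j IHj]; first by rewrite muln1 mul0r addr0.
  rewrite (le_trans _ IHj) // expnS mulnCA mul2n -addnn.
  set n := (N.+1 * 2 ^ j)%N.
  have Nn : (N < n)%N by rewrite leq_pmulr // expn_gt0.
  have := Hblock n n Nn (leqnn n).
  have -> : n%:R / (4 * n%:R) = 4^-1 :> R.
    by field; rewrite pnatr_eq0 -lt0n (leq_ltn_trans _ Nn).
  rewrite -natr1; lra.
have e4 : 0 < eps / 4 by lra.
have := archi_boundP (divr_ge0 (H0 N.+1) (ltW e4)).
rewrite ltr_pdivrMr // => lt.
have := lt_le_trans lt (le_trans _ (Hiter (Num.bound (H N.+1 / (eps / 4))))).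
by rewrite lerDr H0 ltxx => /(_ isT).
Qed.

Section DelayedAveraging.
Variables (R : realType) (q a : nat) (e : nat -> nat -> R).
Hypothesis e01 : forall n r, 0 <= e n r <= 1.
Hypothesis e_periodic : forall n r, e n (r + q)%N = e n r.
Hypothesis e_rec : forall n r, (0 < n)%N -> (a <= n)%N ->
  n.+1%:R * e n.+1 r = n%:R * e n r + e (n - a)%N r.+1.

Lemma delayed_step_le n r : (0 < n)%N -> (a <= n)%N ->
  `|e n.+1 r - e n r| <= n.+1%:R^-1.
Proof.
move=> n0 an; have n1 : (0 : R) < n.+1%:R by rewrite ltr0n.
have E : e n.+1 r - e n r = (e (n - a)%N r.+1 - e n r) / n.+1%:R.
  apply: (mulfI (lt0r_neq0 n1)).
  rewrite mulrBr e_rec // mulrCA divff ?lt0r_neq0 // mulr1 -natr1; ring.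
rewrite E normrM normfV (gtr0_norm n1) ler_piMl ?invr_ge0 ?(ltW n1) //.
have := e01 (n - a) r.+1; have := e01 n r.
by rewrite ler_norml => /andP[? ?] /andP[? ?]; apply/andP; split; lra.
Qed.

(** Each of the [a] steps moves [e] by at most [2 / (n+1)], as its new index is at least
    [(n+1) / 2]. *)
Lemma delayed_drift_le n r : (a.*2 < n)%N ->
  `|e (n - a)%N r - e n r| <= 2 * a%:R / n.+1%:R.
Proof.
move=> an.
have n1 : (0 : R) < n.+1%:R by rewrite ltr0n.
have H k : (k <= a)%N -> `|e (n - a + k)%N r - e (n - a)%N r| <= k%:R * (2 / n.+1%:R).
  elim: k => [_|k IHk ka]; first by rewrite addn0 subrr normr0 mul0r.
  rewrite addnS -(subrKA (e (n - a + k)%N r)) (le_trans (ler_normD _ _)) //.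
  rewrite -natr1 mulrDl mul1r addrC lerD ?IHk ?(ltnW ka) //.
  rewrite (le_trans (delayed_step_le _ _ _)) //; [lia|lia|].
  rewrite ler_pdivlMr // mulrC ler_pdivrMr ?ltr0n //.
  by rewrite -natrM ler_nat; lia.
have := H a (leqnn a); rewrite subnK; last by lia.
by rewrite distrC mulrA [_ * 2]mulrC.
Qed.

(** Trading the delayed value [e (n - a) r.+1] for [e n r.+1] costs the drift times the weight
    [1 / (n+1)], a summable error. *)
Lemma delayed_average_le n r : (a.*2 < n)%N ->
  `|e n.+1 r - ((1 - n.+1%:R^-1) * e n r + n.+1%:R^-1 * e n r.+1)|
    <= 2 * a%:R * n.+1%:R^-1 ^+ 2.
Proof.
move=> an; set h := n.+1%:R^-1.
have n1 : (0 : R) < n.+1%:R by rewrite ltr0n.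
have hn : h * n.+1%:R = 1 by rewrite mulVf ?lt0r_neq0.
have -> : e n.+1 r - ((1 - h) * e n r + h * e n r.+1)
   = h * (e (n - a)%N r.+1 - e n r.+1).
  apply: (mulfI (lt0r_neq0 n1)); rewrite mulrBr e_rec; [|lia|lia].
  have -> : n%:R = n.+1%:R - 1 :> R by rewrite -natr1 addrK.
  by rewrite /h; field; rewrite lt0r_neq0.
have h0 : 0 < h by rewrite invr_gt0.
rewrite normrM (gtr0_norm h0) expr2 mulrCA ler_pM2l //.
exact: delayed_drift_le.
Qed.

Lemma delayed_averaging_flat r : (r < q)%N ->
  (fun n => e n r.+1 - e n r) @ \oo --> (0 : R).
Proof.
move=> rq.
pose w n s := e n s.+1 - e n s.
pose E n := \sum_(s < q) w n s ^+ 2.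
pose A n := \sum_(s < q) e n s ^+ 2.
(* With [h = 1 / (n+1)], [w] averages with error [4 a h^2], twice that of [e]; squaring doubles it
   again and summing gives the factor [q]. *)
pose K : R := 8 * a%:R * q%:R.
have K0 : 0 <= K by rewrite !mulr_ge0.
have w1 n s : -1 <= w n s <= 1.
  rewrite /w; move: (e01 n s) (e01 n s.+1) => /andP[? ?] /andP[? ?].
  by apply/andP; split; lra.
have e1 n s : -1 <= e n s <= 1.
  by move: (e01 n s) => /andP[? ?]; apply/andP; split; lra.
have e_q n : e n q = e n 0%N by rewrite -[q]add0n e_periodic.
have w_q n : w n q = w n 0%N.
  by rewrite /w e_q -(e_periodic n 1) add1n.
have h01 n : 0 <= (n.+1%:R^-1 : R) <= 1.
  by rewrite invr_ge0 ler0n /= invf_le1 ?ltr0n // ler1n.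
have Kdec n : (0 < n)%N -> K * n.+1%:R^-1 ^+ 2 + K / n.+1%:R <= K / n%:R.
  move=> n0; have x0 : (0 : R) < n%:R by rewrite ltr0n.
  rewrite -natr1; set x : R := n%:R in x0 *.
  rewrite -subr_ge0.
  have -> : K / x - (K * (x + 1)^-1 ^+ 2 + K / (x + 1)) = K / (x * (x + 1) ^+ 2).
    by field; rewrite !gt_eqF //; lra.
  by rewrite divr_ge0 // mulr_ge0 ?sqr_ge0 // ltW.
have sum_cst (c : R) : \sum_(s < q) c = c * q%:R.
  by rewrite sumr_const card_ord mulr_natr.
have Estep n : (a.*2 < n)%N -> E n.+1 <= E n + K * n.+1%:R^-1 ^+ 2.
  move=> an; set h := n.+1%:R^-1.
  apply: (@le_trans _ _ (\sum_(s < q) ((1 - h) * w n s ^+ 2 + h * w n s.+1 ^+ 2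
             + 8 * a%:R * h ^+ 2))).
    apply: ler_sum => s _.
    have d : `|w n.+1 s - ((1 - h) * w n s + h * w n s.+1)| <= 4 * a%:R * h ^+ 2.
      have := delayed_average_le s an; have := delayed_average_le s.+1 an.
      rewrite /= -/h /w !ler_norml => /andP[? ?] /andP[? ?]; apply/andP; split; lra.
    have := sqr_convex_comb_le (h01 n) (w1 n s) (w1 n s.+1) (w1 n.+1 s) d.
    have : 0 <= h * (1 - h) * (w n s.+1 - w n s) ^+ 2.
      have /andP[h0 h1] := h01 n.
      by apply: mulr_ge0; [apply: mulr_ge0; rewrite ?subr_ge0|apply: sqr_ge0].
    rewrite -/h; lra.
  rewrite !big_split /= -!mulr_sumr sum_cst.
  rewrite (sum_shift_periodic (f := fun s => w n s ^+ 2)) ?w_q // -/(E n) /K; lra.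
have Astep n : (a.*2 < n)%N ->
    A n.+1 <= A n - n%:R / n.+1%:R ^+ 2 * E n + K * n.+1%:R^-1 ^+ 2.
  move=> an; set h := n.+1%:R^-1.
  have -> : n%:R / n.+1%:R ^+ 2 = h * (1 - h).
    have -> : n%:R = n.+1%:R - 1 :> R by rewrite -natr1 addrK.
    have : n.+1%:R != 0 :> R by rewrite pnatr_eq0.
    by rewrite /h; move: (n.+1%:R : R) => x x0; field.
  apply: (@le_trans _ _ (\sum_(s < q) ((1 - h) * e n s ^+ 2 + h * e n s.+1 ^+ 2
             - h * (1 - h) * w n s ^+ 2 + 4 * a%:R * h ^+ 2))).
    apply: ler_sum => s _.
    have := sqr_convex_comb_le (h01 n) (e1 n s) (e1 n s.+1) (e1 n.+1 s)
      (delayed_average_le s an).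
    rewrite -/h /w; lra.
  rewrite !big_split /= sumrN -!mulr_sumr sum_cst.
  rewrite (sum_shift_periodic (f := fun s => e n s ^+ 2)) ?e_q // -/(E n) -/(A n) /K.
  have : 0 <= a%:R * q%:R * h ^+ 2 by apply: mulr_ge0; [apply: mulr_ge0|apply: sqr_ge0].
  lra.
clearbody K.
(* The correction [K / n] outweighs the errors [K / (n+1)^2]: [G] becomes nonincreasing and [F]
   drops by the weighted energy. *)
pose F n := A n + K / n%:R.
pose G n := E n + K / n%:R.
have F0 n : 0 <= F n.
  by rewrite addr_ge0 ?divr_ge0 // sumr_ge0 // => s _; rewrite sqr_ge0.
have Gdec n : (a.*2.+1 <= n)%N -> G n.+1 <= G n.
  move=> an; have := Estep n an; have := Kdec n (leq_ltn_trans (leq0n _) an).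
  rewrite /G => KE EE; rewrite (le_trans (lerD EE (lexx _))) // -addrA.
  by rewrite lerD2l.
have Fdec n : (a.*2.+1 <= n)%N ->
    F n.+1 <= F n - n%:R / n.+1%:R ^+ 2 * (G n - K / n%:R).
  move=> an; have := Astep n an; have := Kdec n (leq_ltn_trans (leq0n _) an).
  rewrite /F /G addrK => KE AE; rewrite (le_trans (lerD AE (lexx _))) // -addrA.
  by rewrite [leRHS]addrAC lerD2l.
apply/cvgrPdist_lt => eps eps0.
(* [G] bounds the square of [w n r], hence the threshold [eps ^+ 2]. *)
have [M _ GM] := dissipation_small K0 F0 Gdec Fdec (exprn_gt0 2 eps0).
exists M => // n /= Mn; rewrite sub0r normrN.
rewrite -(@ltr_pXn2r _ 2) ?nnegrE ?(ltW eps0) // real_normK ?num_real //.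
apply: le_lt_trans (GM n Mn).
rewrite /G /E (bigD1 (Ordinal rq)) //= -addrA lerDl addr_ge0 ?divr_ge0 //.
by rewrite sumr_ge0 // => s _; rewrite sqr_ge0.
Qed.

Lemma delayed_averaging_equidistributed r : (r < q)%N ->
  (fun n => q%:R * e n r - \sum_(s < q) e n s) @ \oo --> (0 : R).
Proof.
move=> rq.
have flat0 s : (s < q)%N -> (fun n => e n s - e n 0%N) @ \oo --> (0 : R).
  elim: s => [_|s IHs sq].
    by under eq_fun do rewrite subrr; exact: cvg_cst.
  under eq_fun => n do rewrite -(subrKA (e n s)).
  rewrite -(addr0 (0 : R)); apply: cvgD.
    exact/delayed_averaging_flat/ltnW.
  exact/IHs/ltnW.
have -> : (fun n => q%:R * e n r - \sum_(s < q) e n s) =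
    (fun n => \sum_(s < q) ((e n r - e n 0%N) - (e n s - e n 0%N))).
  apply/funext => n; under [RHS]eq_bigr do rewrite opprB addrA subrK.
  by rewrite sumrB sumr_const card_ord mulr_natl.
have sum0 : \sum_(s < q) (0 - 0) = 0 :> R.
  by rewrite big1 // => s _; rewrite subrr.
rewrite -[in X in _ --> X]sum0.
apply: (cvg_big add_continuous) => s _.
by apply: cvgB; apply: flat0.
Qed.

End DelayedAveraging.

(** First [n * x n >= 1] for [n > a]: the value [x 0 = 1] enters at [n = a + 1], and the product
    never decreases afterwards. This settles [n <= 2 a + 1]; beyond, [x n] is a weighted mean of two
    earlier terms of index greater than [a]. *)
Lemma delayed_average_lower_bound (R : realFieldType) (a : nat) (x : nat -> R) :
  (0 < a)%N -> (forall n, 0 <= x n) -> x 0%N = 1 ->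
  (forall n, (0 < n)%N -> (a <= n)%N ->
     n.+1%:R * x n.+1 = n%:R * x n + x (n - a)%N) ->
  forall n, (a < n)%N -> (a.*2.+1)%:R^-1 <= x n.
Proof.
move=> a0 x0 x01 xrec.
have nx n : (a < n)%N -> 1 <= n%:R * x n.
  elim: n => // n IHn; rewrite ltnS leq_eqVlt => /orP[/eqP <-|an].
    by rewrite xrec // subnn x01 lerDr mulr_ge0.
  by apply: le_trans (IHn an) _; rewrite xrec ?(ltnW an) ?lerDl //; lia.
move=> n; have [m] := ubnP n; elim: m n => // m IHm n nm an.
have d0 : (0 : R) < (a.*2.+1)%:R by rewrite ltr0n.
have [na|na] := leqP n a.*2.+1.
  rewrite -[_^-1]mul1r ler_pdivrMr // (le_trans (nx n an)) // mulrC.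
  by rewrite ler_wpM2l // ler_nat.
case: n => // n in nm an na *.
have n0 : (0 : R) < n.+1%:R by rewrite ltr0n.
rewrite -(ler_pM2l n0) xrec; [|lia|lia].
rewrite -natr1 mulrDl mul1r lerD // ?ler_wpM2l // IHm //; lia.
Qed.

(** * Proportions among all permutations, and their limits *)

Section NormalizedCounts.
Variables (R : realType) (a : nat).
Hypothesis a_gt0 : (0 < a)%N.

Definition derangement_freq (P : pred nat) (n : nat) : R :=
  (num_derangements_such_that a n P)%:R / n`!%:R.

(** Since [n! = n ^_ a * (n - a)!], dividing by factorials removes the falling factorial. *)
Lemma derangement_freq_rec P n : (0 < n)%N -> (a <= n)%N ->
  n.+1%:R * derangement_freq P n.+1 =
  n%:R * derangement_freq P n + derangement_freq (P \o succn) (n - a).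
Proof.
move=> n0 an; rewrite /derangement_freq num_derangements_such_that_rec //.
have fact_neq0 m : m`!%:R != 0 :> R by rewrite pnatr_eq0 -lt0n fact_gt0.
have n1 : n.+1%:R != 0 :> R by rewrite pnatr_eq0.
have ff0 : (n ^_ a)%:R != 0 :> R by rewrite pnatr_eq0 -lt0n ffact_gt0.
rewrite factS -(ffact_fact an) natrD !natrM.
move: (fact_neq0 (n - a)%N) n1 ff0.
move: (n - a)`!%:R n.+1%:R (n ^_ a)%:R => u v w u0 v0 w0.
by field; rewrite u0 v0 w0.
Qed.

Lemma derangement_freq_ge0 P n : 0 <= derangement_freq P n.
Proof. by rewrite divr_ge0. Qed.

Lemma derangement_freq_le1 P n : derangement_freq P n <= 1.
Proof.
rewrite ler_pdivrMr ?ltr0n ?fact_gt0 // mul1r ler_nat.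
exact: num_derangements_such_that_le.
Qed.

Lemma derangement_freq_lower_bound n : (a < n)%N ->
  (a.*2.+1)%:R^-1 <= derangement_freq predT n.
Proof.
apply: delayed_average_lower_bound => //.
- by move=> m; apply: derangement_freq_ge0.
- rewrite /derangement_freq fact0 divr1 num_derangements_such_that_predT.
  by rewrite num_derangements0.
- by move=> m m0 am; rewrite derangement_freq_rec.
Qed.

Lemma residue_share_cvg q s : (s < q)%N ->
  (fun n => (num_derangements_such_that a n (fun k => q %| k + s)%N)%:R
            / (num_derangements n a)%:R : R) @ \oo --> (q%:R^-1 : R).
Proof.
move=> sq; have q0 : (0 < q)%N by apply: leq_ltn_trans sq.
(* Composing with [succn] raises [t] by one, so the recurrence becomes the delayed cyclic shift. *)
pose e n t := derangement_freq (fun k => q %| k + t)%N n.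
pose D := derangement_freq predT.
have qR : (0 : R) < q%:R by rewrite ltr0n.
have sumE n : \sum_(t < q) e n t = D n.
  rewrite /e /D /derangement_freq -mulr_suml -natr_sum.
  by rewrite sum_num_derangements_such_that_residue // num_derangements_such_that_predT.
have e01 n t : 0 <= e n t <= 1.
  by rewrite derangement_freq_ge0 derangement_freq_le1.
have e_periodic n t : e n (t + q)%N = e n t.
  congr (_%:R / _); apply: eq_num_derangements_such_that => k.
  by rewrite addnA dvdn_addl.
have e_rec n t : (0 < n)%N -> (a <= n)%N ->
    n.+1%:R * e n.+1 t = n%:R * e n t + e (n - a)%N t.+1.
  move=> n0 an; rewrite /e derangement_freq_rec //; congr (_ + _).
  congr (_%:R / _); apply: eq_num_derangements_such_that => k /=.
  by rewrite addSnnS.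
have := delayed_averaging_equidistributed e01 e_periodic e_rec sq.
under eq_fun do rewrite sumE.
set u := (fun n => _) => u0.
set d : R := (a.*2.+1)%:R^-1.
have d0 : 0 < d by rewrite invr_gt0 ltr0n.
apply/cvgrPdist_lt => eps eps0.
have ed0 : 0 < eps * d by rewrite mulr_gt0.
(* Tolerance for [u n]: up to sign, the deviation from [1 / q] is [u n / (q * D n)], and
   [D n >= d]. *)
have qed0 : 0 < q%:R * eps * d by rewrite !mulr_gt0.
move/cvgrPdist_lt: u0 => /(_ _ qed0) u_small.
near=> n.
have an : (a < n)%N by near: n; exists a.+1.
have Dd : d <= D n by apply: derangement_freq_lower_bound.
have D0 : 0 < D n by apply: lt_le_trans Dd.
have fact0 : n`!%:R != 0 :> R by rewrite pnatr_eq0 -lt0n fact_gt0.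
have -> : (num_derangements_such_that a n (fun k => q %| k + s)%N)%:R
            / (num_derangements n a)%:R = e n s / D n :> R.
  rewrite /e /D /derangement_freq num_derangements_such_that_predT.
  by rewrite invf_div mulrA divfK.
have -> : q%:R^-1 - e n s / D n = - (u n / (q%:R * D n)).
  by rewrite /u; field; rewrite !gt_eqF.
have qD0 : 0 < q%:R * D n by rewrite mulr_gt0.
rewrite normrN normrM normfV (gtr0_norm qD0) ltr_pdivrMr //.
have un : `|0 - u n| < q%:R * eps * d by near: n.
rewrite sub0r normrN in un; apply: (lt_le_trans un).
by rewrite -mulrA [leRHS]mulrCA !ler_pM2l.
Unshelve. all: by end_near.
Qed.

End NormalizedCounts.

(* The second sum runs over the naturals j <= floor((m - r) / q), where the
   difference and the floor are taken in int: for m < r the floor is -1 and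
   the sum is empty. The bound j < m.+1 only makes the range finite, as
   floor((m - r) / q) <= m. *)
Theorem theorem3p8 (R : realType) (q r a : nat) (hr : (r < q)%N)
    (ha : (0 < a)%N) :
  ((fun n : nat =>
      (\sum_(0 <= j < ((n %/ a) %/ q).+1)
         num_derangements_cycles a n (r + j * q))%N%:R
      / (num_derangements n a)%:R : R) @ \oo --> (q%:R^-1 : R))
  /\
  ((fun n : nat =>
      (\sum_(0 <= j < (n %/ a).+1 |
             ((j%:Z <= ((n %/ a)%N%:Z - r%:Z) %/ q%:Z)%Z)%R)
         num_derangements_cycles a n (q * j + r))%N%:R
      / (num_derangements n a)%:R : R) @ \oo --> (q%:R^-1 : R)).
Proof.
have q0 : (0 < q)%N by apply: leq_ltn_trans hr.
(* Reduced modulo [q] because [q - r = q] when [r = 0]. *)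
pose s := ((q - r) %% q)%N.
have share := @residue_share_cvg R a ha q s (ltn_pmod _ q0).
have classE n : num_derangements_such_that a n (fun k => q %| k + s)%N =
    num_derangements_such_that a n (fun k => q %| k + (q - r))%N.
  by apply: eq_num_derangements_such_that => k; rewrite /dvdn modnDmr.
split.
  under eq_fun => n.
    rewrite (sum_num_derangements_cycles ha hr) -?classE; last first.
      move=> j rj; rewrite andbT ltnS leq_divRL // (leq_trans _ rj) ?leq_addl //.
    over.
  exact: share.
under eq_fun => n.
  under eq_bigr do rewrite mulnC addnC.
  rewrite (sum_num_derangements_cycles ha hr) -?classE; last first.
    (* With [m = n %/ a], [r + j * q <= m] yields [j <= m] as [q >= 1], and [j * q <= m - r] in
       [int]. *)
    move=> j rj; rewrite ltnS lez_divRL //.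
    apply/andP; split.
      by rewrite (leq_trans _ rj) // (leq_trans _ (leq_addl _ _)) // leq_pmulr.
    by rewrite lerBrDl -PoszM -PoszD lez_nat.
  over.
exact: share.
Qed.
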